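(* There is a deterministic algorithm in the $\mathsf{LOCAL}$ model that solves $\mathsf{Broadcast}$ on any $n$-vertex network in $O(n\log n\log N)$ time using $O(\log n\log N)$ energy.
   Context: Radio network: connected undirected graph with $n$ vertices; synchronized slots; each vertex transmits, listens or idles per slot, transmit/listen costing one unit of energy; energy = maximum per-vertex number of such slots. $\mathsf{LOCAL}$: a listener receives every message sent by its neighbors in that slot. Deterministic setting: vertices have distinct IDs in $\{1,\ldots,N\}$. $\mathsf{Broadcast}$: a source vertex holds a message that all vertices must learn. *)

(* Defs.v *)
From mathcomp Require Import all_boot.
Set Implicit Arguments. Unset Strict Implicit. Unset Printing Implicit Defensive.

Inductive action (Msg : Type) : Type :=
| Transmit of Msg
| Listen
| Idle.
Arguments Listen {Msg}.
Arguments Idle {Msg}.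

(* A deterministic distributed algorithm.  Every vertex runs the same
   state machine.  Its initial state depends only on the globally known
   parameters n (number of vertices) and N (ID range), on its own ID, and on
   whether it is the source (Some m, where m is the broadcast message) or not
   (None).  Messages are of an arbitrary type (LOCAL: unbounded size).
   In each slot the vertex chooses an action from its current state; it then
   moves to a new state, receiving [Some l] (l = messages transmitted by its
   neighbours in that slot) if it listened, and [None] otherwise.  [a_out]
   is the vertex's current knowledge of the broadcast message. *)
Record algorithm : Type := Algorithm {
  St : Type;
  Msg : Type;
  a_init : nat -> nat -> nat -> option nat -> St;
  a_act : St -> action Msg;
  a_next : St -> option (seq Msg) -> St;
  a_out : St -> option nat
}.

Section Exec.
Variables (A : algorithm) (n N : nat) (e : rel 'I_n) (id : 'I_n -> nat)
          (s : 'I_n) (m : nat).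

Definition transmitted (x : action (Msg A)) : option (Msg A) :=
  if x is Transmit y then Some y else None.

Definition received (cur : 'I_n -> St A) (v : 'I_n) : seq (Msg A) :=
  pmap (fun u => if e v u then transmitted (a_act (cur u)) else None)
       (enum 'I_n).

Definition step (cur : 'I_n -> St A) (v : 'I_n) : St A :=
  a_next (cur v)
    (if a_act (cur v) is Idle then None else
     if a_act (cur v) is Listen then Some (received cur v) else None).

(* state t v = state of vertex v at the beginning of slot t *)
Fixpoint state (t : nat) : 'I_n -> St A :=
  if t is t'.+1 then step (state t') else
  fun v => @a_init A n N (id v) (if v == s then Some m else None).

Definition energy_of (T : nat) (v : 'I_n) : nat :=
  count (fun t => if a_act (state t v) is Idle then false else true)
        (iota 0 T).
End Exec.

Definition connected_graph (n : nat) (e : rel 'I_n) : Prop :=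
  irreflexive e /\ symmetric e /\ (forall x y : 'I_n, connect e x y).

Definition valid_ids (n N : nat) (id : 'I_n -> nat) : Prop :=
  injective id /\ (forall v, 1 <= id v <= N).

Definition solves_broadcast (A : algorithm) (n N : nat) (e : rel 'I_n)
  (id : 'I_n -> nat) (s : 'I_n) (m : nat) (T E : nat) : Prop :=
  (forall v, a_out (state A N e id s m T v) = Some m) /\
  (forall v, energy_of A N e id s m T v <= E).

(* Main.v *)
Require Import Defs.
From mathcomp Require Import all_boot zify.
From Stdlib Require Import FunctionalExtensionality.
Set Implicit Arguments. Unset Strict Implicit. Unset Printing Implicit Defensive.

(* Vertices are grouped into clusters; a cluster is named by the ID of its root
   and every other vertex has a neighbour in its cluster whose depth is one
   less.  Scheduling transmissions by depth, a cluster can gather information at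
   its root and spread it again in O(n) slots, each vertex being active O(1)
   times.  In a stage the clusters are split into movers and stayers, and every
   mover with an adjacent stayer is absorbed by one.  A phase has one stage for
   each bit of the cluster name (movers have bit 1), and a last one in which the
   clusters that have not yet doubled in size move.  Two adjacent clusters that
   survive a bit stage without any merge agree on that bit, so before the last
   stage no two clusters that have not doubled are adjacent, and after it all
   have doubled.  After log n phases a single cluster is left and gathering
   reaches every vertex. *)

(* [rid] is the ID of the root of the cluster and [dep] the depth; [items] is
   the set of IDs being gathered, [con] the label offered by an adjacent stayer,
   and [lab] the label (rid, dep) that will hold from the next stage on. *)
Record core : Type := Core {
  cid : nat;
  rid : nat;
  dep : nat;
  know : option nat;
  items : seq nat;
  con : option (nat * nat);
  lab : option (nat * nat)
}.

Definition set_con x c := Core (cid x) (rid x) (dep x) (know x) (items x) c (lab x).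

(** Messages from other clusters are dropped. A received label has its depth raised by one, which
    makes its sender the parent, and a label once held is never replaced. *)
Definition merge (x : core) (ys : seq core) : core :=
  let zs := [seq y <- ys | rid y == rid x] in
  Core (cid x) (rid x) (dep x)
    (if know x is Some k then Some k else ohead (pmap know zs))
    (items x ++ flatten (map items zs)) (con x)
    (if lab x is Some l then Some l
     else ohead (pmap (fun y => omap (fun l => (l.1, l.2.+1)) (lab y)) zs)).

(** Stage [q] is number [j] in phase [q %/ (up_log 2 N).+1]. Names lie in 1..N, so [(rid x).-1] has
    at most [up_log 2 N] bits. Sweeps collect duplicates, hence [undup]. *)
Definition mover (N q : nat) (x : core) : bool :=
  let j := q %% (up_log 2 N).+1 in
  if j < up_log 2 N then odd ((rid x).-1 %/ 2 ^ j)
  else size (undup (items x)) < 2 ^ (q %/ (up_log 2 N).+1).+1.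

(* A stage consists of blocks 0..6 of B = 2n slots.  Blocks (0,1), (3,4), (5,6)
   are sweeps, towards the root and back; they gather the member IDs, gather the
   IDs of the vertices with a contact, and propagate the new labels.  In block 2
   stayers transmit and movers listen.  In slot i of a sweep block, depth
   [(link_of B k i).1] transmits to depth [(link_of B k i).2]. *)
Definition link_of (B k i : nat) : nat * nat :=
  if k \in [:: 0; 3; 5] then (B - i, B - i.+1) else (i, i.+1).

Definition core_act (N B b i : nat) (x : core) : action core :=
  if b %% 7 == 2 then
    if i == 0 then if mover N (b %/ 7) x then Listen else Transmit x else Idle
  else if dep x == (link_of B (b %% 7) i).1 then Transmit x
  else if dep x == (link_of B (b %% 7) i).2 then Listen else Idle.

Definition core_upd (b : nat) (x : core) (inp : option (seq core)) : core :=
  if inp is Some ys then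
    if b %% 7 == 2 then set_con x (ohead [seq (rid y, (dep y).+1) | y <- ys])
    else merge x ys
  else x.

Definition finish (b : nat) (x : core) : core :=
  match b %% 7 with
  | 2 => Core (cid x) (rid x) (dep x) (know x)
           (if con x is Some _ then [:: cid x] else [::]) (con x) (lab x)
  | 4 => Core (cid x) (rid x) (dep x) (know x) (items x) (con x)
           (* the contact vertex of least ID decides where the cluster goes *)
           (if all (leq (cid x)) (items x) then con x else None)
  | 6 => if lab x is Some l
         then Core (cid x) l.1 l.2 (know x) [:: cid x] None None
         else Core (cid x) (rid x) (dep x) (know x) [:: cid x] None None
  | _ => x
  end.

Record vertex_state : Type := VS { vn : nat; vN : nat; clock : nat; vcore : core }.

Definition vs_act (s : vertex_state) : action core :=
  let B := 2 * vn s in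
  core_act (vN s) B (clock s %/ B) (clock s %% B) (vcore s).

Definition vs_next (s : vertex_state) (inp : option (seq core)) : vertex_state :=
  let B := 2 * vn s in
  let b := clock s %/ B in
  let x := core_upd b (vcore s) inp in
  VS (vn s) (vN s) (clock s).+1
     (if (clock s %% B).+1 == B then finish b x else x).

Definition merging_algorithm : algorithm :=
  @Algorithm vertex_state core
    (fun n N i o => VS n N 0 (Core i i 0 o [:: i] None None))
    vs_act vs_next (fun s => know (vcore s)).

(** * Halving the number of clusters *)

Section Halving.
Variables (n : nat) (e : rel 'I_n).

Definition cluster (r : 'I_n -> nat) (v : 'I_n) : {set 'I_n} :=
  [set u | r u == r v].

(** The interface between a distributed stage and the counting of clusters, [r] and [r'] being the
    names before and after. Movers only join stayers, which keep their names, so merges never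
    chain. *)
Definition absorb (M : pred 'I_n) (r r' : 'I_n -> nat) : Prop :=
  [/\ forall u v, r u = r v -> M u = M v,
      forall u v, r u = r v -> r' u = r' v,
      forall v, ~~ M v -> r' v = r v,
      forall v, r' v = r v \/ exists2 w, ~~ M w & r' v = r w
    & forall u w, M u -> ~~ M w -> e u w -> r' u != r u].

Section OneStage.
Variables (M : pred 'I_n) (r r' : 'I_n -> nat).
Hypothesis A : absorb M r r'.

Lemma absorb_sub v : cluster r v \subset cluster r' v.
Proof.
case: A => _ A2 _ _ _; apply/subsetP=> u; rewrite !inE => /eqP /A2 ->.
exact: eqxx.
Qed.

Lemma absorb_leq h v : h <= #|cluster r v| -> h <= #|cluster r' v|.
Proof. by move/leq_trans; apply; apply: subset_leq_card; apply: absorb_sub. Qed.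

(** The new name is that of a stayer, whose cluster is disjoint from the old cluster of [v]; the new
    cluster contains both. *)
Lemma absorb_double h v :
  (forall u, h <= #|cluster r u|) -> r' v != r v -> h.*2 <= #|cluster r' v|.
Proof.
move=> hr ne; case: (A) => _ _ A3 A4 _.
case: (A4 v) => [E|[w Mw E]]; first by rewrite E eqxx in ne.
have dis : [disjoint cluster r v & cluster r w].
  rewrite -setI_eq0; apply/eqP/setP=> u; rewrite !inE.
  by apply/negP=> /andP [/eqP -> /eqP E2]; rewrite E E2 eqxx in ne.
have sub : cluster r v :|: cluster r w \subset cluster r' v.
  rewrite subUset absorb_sub /=.
  have -> : cluster r' v = cluster r' w.
    by apply/setP=> u; rewrite !inE E (A3 w Mw).
  exact: absorb_sub.
apply: leq_trans (subset_leq_card sub).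
by rewrite cardsU disjoint_setI0 // cards0 subn0 -addnn leq_add.
Qed.

Lemma absorb_const : (forall u v, r u = r v) -> forall u v, r' u = r' v.
Proof. by case: A => _ A2 _ _ _ H u v; apply: A2. Qed.
End OneStage.

Lemma cut_edge (r : 'I_n -> nat) (u v : 'I_n) :
  connect e u v -> r u != r v -> exists x y, [/\ r x = r u, r y != r u & e x y].
Proof.
case/connectP=> p; elim: p u => [|w p IH] u /=.
  by move=> _ ->; rewrite eqxx.
case/andP=> euw pw lastv ne.
have [E|ne'] := eqVneq (r w) (r u); last by exists u, w.
rewrite -E; apply: IH => //; by rewrite E.
Qed.

(** * A phase doubles the least cluster size *)

Section Phase.
Hypothesis sym : symmetric e.
Hypothesis conn : forall x y : 'I_n, connect e x y.
Variables (L h : nat) (r : nat -> 'I_n -> nat).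
Hypothesis rpos : forall j v, 0 < r j v <= 2 ^ L.
Hypothesis bits : forall j, j < L ->
  absorb (fun v => odd ((r j v).-1 %/ 2 ^ j)) (r j) (r j.+1).
Hypothesis last : absorb (fun v => #|cluster (r L) v| < h.*2) (r L) (r L.+1).
Hypothesis start : forall v, h <= #|cluster (r 0) v|.

Let small j v := #|cluster (r j) v| < h.*2.

Lemma phase_leq j v : j <= L -> h <= #|cluster (r j) v|.
Proof.
elim: j => [|j IH] jL; first exact: start.
exact: absorb_leq (bits jL) _ _ (IH (ltnW jL)).
Qed.

(** Induction on [j]. A cluster still small after a stage did not move in it, since moving gives
    size at least [h.*2]. If two adjacent ones disagreed on the bit of that stage, the mover of the
    two would have had to move; so they agree on it, and their quotients were already equal one
    stage earlier. *)
Lemma small_adjacent j u v : j <= L -> e u v -> small j u -> small j v ->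
  (r j u).-1 %/ 2 ^ j = (r j v).-1 %/ 2 ^ j -> r j u = r j v.
Proof.
elim: j u v => [|j IH] u v jL euv su sv.
  (* Names are positive, so [.-1] is injective on them. *)
  by rewrite expn0 !divn1; have := rpos 0 u; have := rpos 0 v; lia.
have A := bits jL.
have jL' := ltnW jL.
have unmoved w : small j.+1 w -> r j.+1 w = r j w.
  move=> sw; apply/eqP; apply: contraLR sw => ne; rewrite /small -leqNgt.
  by apply: (absorb_double A) ne => x; apply: phase_leq.
have back w : small j.+1 w -> small j w.
  rewrite /small => sw; apply: leq_ltn_trans sw.
  by apply: subset_leq_card; apply: absorb_sub A _.
have [_ _ _ _ A5] := A.
rewrite !unmoved // expnSr !divnMA !divn2 => Eq.
apply: IH => //; try exact: back.
have Ou : odd ((r j u).-1 %/ 2 ^ j) = odd ((r j v).-1 %/ 2 ^ j).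
  have := A5 u v; have := A5 v u; rewrite sym euv !unmoved // !eqxx.
  by case: (odd _); case: (odd _) => // H1 H2; [have := H1 isT isT isT | have := H2 isT isT isT].
by rewrite -(odd_double_half (_ %/ 2 ^ j)) Eq Ou odd_double_half.
Qed.

(** A cluster still small before the last stage is a mover and, unless it is the only one, has an
    edge leaving it. The other end lies in a large cluster, hence a stayer, so the small one moves
    and doubles. *)
Lemma phase_double :
  (forall u v, r L u = r L v) \/ forall v, h.*2 <= #|cluster (r L.+1) v|.
Proof.
have [/forallP /= H|] := boolP [forall u, [forall v, r L u == r L v]].
  by left=> u v; apply/eqP; move/forallP: (H u).
rewrite negb_forall => /existsP [a]; rewrite negb_forall => /existsP [b nab].
right=> v; case: (leqP h.*2 #|cluster (r L) v|) => [|sv].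
  exact: absorb_leq last _ _.
apply: (absorb_double last) => [u|]; first exact: phase_leq.
have [w nw] : exists w, r L v != r L w.
  have [E|] := eqVneq (r L v) (r L a); last by exists a.
  by exists b; rewrite E.
have [x [y [xv yv exy]]] := cut_edge (conn v w) nw.
have [M1 M2 _ _ A5] := last.
have cx : cluster (r L) x = cluster (r L) v.
  by apply/setP=> u; rewrite !inE xv.
rewrite -(M2 _ _ xv) -xv; apply: (A5 x y) => //; first by rewrite cx.
(* If [y] were small too, [small_adjacent] at [j = L] would force equal names: both quotients vanish
   because names are at most [2 ^ L]. *)
apply/negP=> sy; case/negP: yv; rewrite -xv eq_sym; apply/eqP.
apply: (small_adjacent (leqnn L)) => //; first by rewrite /small cx.
by rewrite !divn_small //; have := rpos L x; have := rpos L y; lia.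
Qed.
End Phase.
End Halving.

(** * Sweeps inside the clusters *)

Section Sweep.
Variables (n : nat) (e : rel 'I_n).

Definition link (a b : nat) (x : 'I_n -> core) (v : 'I_n) : core :=
  if dep (x v) == b
  then merge (x v) [seq x u | u <- enum 'I_n & e v u && (dep (x u) == a)]
  else x v.

Fixpoint run (f : nat -> nat * nat) (k : nat) (x : 'I_n -> core) : 'I_n -> core :=
  if k is k'.+1 then link (f k').1 (f k').2 (run f k' x) else x.

Definition sweep (B : nat) (x : 'I_n -> core) : 'I_n -> core :=
  run (fun i => (i, i.+1)) B (run (fun i => (B - i, B - i.+1)) B x).

Lemma run_ind (I : ('I_n -> core) -> Prop) :
  (forall a b y, I y -> I (link a b y)) -> forall f k x, I x -> I (run f k x).
Proof. by move=> H f k x Ix; elim: k => //= k IH; apply: H. Qed.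

Lemma sweep_ind (I : ('I_n -> core) -> Prop) B x :
  (forall a b y, I y -> I (link a b y)) -> I x -> I (sweep B x).
Proof. by move=> H Ix; do 2!apply: run_ind => //. Qed.

(** The fields that no slot of a sweep changes. *)
Definition skel (x : core) := (cid x, rid x, dep x, con x).

Lemma skel_link a b x v : skel (link a b x v) = skel (x v).
Proof. by rewrite /link; case: ifP. Qed.

Lemma skel_run f k x v : skel (run f k x v) = skel (x v).
Proof.
by apply: (run_ind (I := fun y => skel (y v) = skel (x v))) => // a b y <-; apply: skel_link.
Qed.

Lemma skel_sweep B x v : skel (sweep B x v) = skel (x v).
Proof. by rewrite !skel_run. Qed.

Lemma link_mem a b x v i : i \in items (link a b x v) ->
  exists2 u, rid (x u) = rid (x v) & i \in items (x u).
Proof.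
rewrite /link; case: ifP => _; last by exists v.
rewrite /= mem_cat => /orP [?|]; first by exists v.
case/flattenP=> s; rewrite filter_map -map_comp => /mapP [u].
by rewrite mem_filter => /andP [/eqP ? _] -> ?; exists u.
Qed.

Lemma ohead_pmap_map (I : eqType) (T U : Type) (f : T -> option U) (g : I -> T)
  (us : seq I) a :
  ohead (pmap f (map g us)) = Some a -> exists2 u, u \in us & f (g u) = Some a.
Proof.
elim: us => //= u us IH; case E: (f (g u)) => [c|] /= H.
  by exists u; rewrite ?mem_head // E.
by have [w wus Ew] := IH H; exists w; rewrite // in_cons wus orbT.
Qed.

Lemma ohead_pmap_has (T U : Type) (f : T -> option U) (s : seq T) :
  isSome (ohead (pmap f s)) = has (fun y => isSome (f y)) s.
Proof. by elim: s => //= y s <-; case: (f y). Qed.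

Lemma link_know a b x v k : know (link a b x v) = Some k ->
  exists u, know (x u) = Some k.
Proof.
rewrite /link; case: ifP => _ /=; last by exists v.
case E: (know (x v)) => [k'|]; first by move=> <-; exists v.
by rewrite filter_map => H; have [u _ ?] := ohead_pmap_map H; exists u.
Qed.

Lemma link_lab a b x v l : lab (link a b x v) = Some l ->
  lab (x v) = Some l \/
  lab (x v) = None /\
  exists u l', [/\ e v u, rid (x u) = rid (x v), lab (x u) = Some l' & l = (l'.1, l'.2.+1)].
Proof.
rewrite /link; case: ifP => _ /=; last by left.
case E: (lab (x v)) => [k'|]; first by left.
rewrite filter_map => H; have [u] := ohead_pmap_map H.
rewrite !mem_filter => /andP [/eqP ru /andP [/andP [evu _] _]].
by case lu: (lab _) => [l'|] //= [<-]; right; split=> //; exists u, l'.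
Qed.

Lemma link_lab_keep a b x v l : lab (x v) = Some l -> lab (link a b x v) = Some l.
Proof. by rewrite /link; case: ifP => //= _ ->. Qed.

(** Closure under receipt from the own cluster; one spreading argument then serves [know], [lab] and
    membership in [items]. *)
Definition carried (Q : pred core) := forall x ys,
  Q x || has (fun y => (rid y == rid x) && Q y) ys -> Q (merge x ys).

Lemma has_filter_pred (T : Type) (p Q : pred T) s :
  has Q (filter p s) = has (fun y => p y && Q y) s.
Proof. by elim: s => //= y s <-; case: (p y). Qed.

Lemma carried_know : carried (fun x => isSome (know x)).
Proof.
move=> x ys; rewrite /merge /=; case: (know x) => //=.
by rewrite ohead_pmap_has has_filter_pred.
Qed.

Lemma carried_lab : carried (fun x => isSome (lab x)).
Proof.
move=> x ys; rewrite /merge /=; case: (lab x) => //=.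
rewrite ohead_pmap_has has_filter_pred => H; apply: etrans H.
by apply: eq_has => y; case: (lab y).
Qed.

Lemma carried_mem i : carried (fun x => i \in items x).
Proof.
move=> x ys; rewrite /merge /= mem_cat => /orP [->//|]; rewrite -has_filter_pred.
move=> H; apply/orP; right; elim: (filter _ _) H => //= y s IH.
by rewrite mem_cat => /orP [->//|/IH ->]; rewrite orbT.
Qed.

Section Spread.
Variables (Q : pred core).
Hypothesis CQ : carried Q.

Lemma link_keep a b x v : Q (x v) -> Q (link a b x v).
Proof. by rewrite /link; case: ifP => // _ H; apply: CQ; rewrite H. Qed.

Lemma run_keep f k x v : Q (x v) -> Q (run f k x v).
Proof.
by move=> H; apply: (run_ind (I := fun y => Q (y v))) => // a b y; apply: link_keep.
Qed.

Lemma sweep_keep B x v : Q (x v) -> Q (sweep B x v).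
Proof. by move=> H; do 2!apply: run_keep. Qed.

Lemma link_pass a b x u v : e v u -> dep (x u) = a -> dep (x v) = b ->
  rid (x u) = rid (x v) -> Q (x u) -> Q (link a b x v).
Proof.
move=> evu du dv ru Qu; rewrite /link dv eqxx; apply: CQ.
rewrite has_map; apply/orP; right; apply/hasP; exists u.
  by rewrite mem_filter evu du eqxx mem_enum.
by rewrite /= ru eqxx.
Qed.
End Spread.

(** Parent edges lead from each vertex to the root naming its cluster. Depths need not be graph
    distances. *)
Definition labelled (id : 'I_n -> nat) (x : 'I_n -> core) := forall v,
  if dep (x v) is d.+1
  then exists u, [/\ e v u, rid (x u) = rid (x v) & dep (x u) = d]
  else rid (x v) = id v.

Section Labelled.
Variables (id : 'I_n -> nat) (x : 'I_n -> core).
Hypothesis lx : labelled id x.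

Lemma labelled_below v d : d <= dep (x v) ->
  exists2 u, rid (x u) = rid (x v) & dep (x u) = d.
Proof.
move E: (dep (x v)) => k; elim: k v E => [|k IH] v dv.
  by rewrite leqn0 => /eqP ->; exists v.
rewrite leq_eqVlt => /orP [/eqP ->|]; first by exists v.
rewrite ltnS => le; have := lx v; rewrite dv => -[u [_ ru du]].
by have [w rw dw] := IH u du le; exists w; rewrite ?rw.
Qed.

Lemma labelled_root v : exists u, [/\ rid (x u) = rid (x v), dep (x u) = 0 & rid (x v) = id u].
Proof.
have [u ru du] := labelled_below (leq0n (dep (x v))).
by exists u; split=> //; have := lx u; rewrite du ru.
Qed.

(** All depths from 0 to [dep (x v)] occur among the [n] vertices. This is why a sweep fits into
    blocks of length at least [n]. *)
Lemma labelled_dep v : dep (x v) < n.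
Proof.
have H : {subset iota 0 (dep (x v)).+1 <= [seq dep (x u) | u <- enum 'I_n]}.
  move=> d; rewrite mem_iota /= add0n ltnS => /labelled_below [u _ <-].
  by apply: map_f; rewrite mem_enum.
have := uniq_leq_size (iota_uniq _ _) H.
by rewrite size_iota size_map size_enum_ord.
Qed.

Hypothesis sym : symmetric e.
Hypothesis inj : injective id.

(** Upward half: after [k] slots some vertex of the cluster at depth at most [B - k] has [Q], in the
    end the root. Downward half: after [k] slots every vertex of the cluster at depth at most [k]
    has it. *)
Lemma sweep_spread Q B v w : carried Q -> n <= B ->
  rid (x w) = rid (x v) -> Q (x w) -> Q (sweep B x v).
Proof.
move=> CQ nB rw Qw.
have depB u : dep (x u) < B by apply: leq_trans (labelled_dep u) nB.
have skE f k z u : rid (run f k z u) = rid (z u) /\ dep (run f k z u) = dep (z u).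
  by have := skel_run f k z u; case=> _ -> ->.
set up := fun i => (B - i, B - i.+1).
have Up k : k <= B -> exists u,
    [/\ rid (x u) = rid (x v), dep (x u) <= B - k & Q (run up k x u)].
  elim: k => [|k IH] kB; first by exists w; rewrite subn0 ltnW.
  have [u [ru du Qu]] := IH (ltnW kB); have [s1 s2] := skE up k x u.
  (* A carrier at depth exactly [B - k] hands [Q] to its parent in this slot; a shallower one just
     keeps it. *)
  move: du; rewrite leq_eqVlt => /orP [/eqP du|du]; last first.
    by exists u; split=> //=; [lia | apply: link_keep].
  have := lx u; rewrite du; have -> : B - k = (B - k.+1).+1 by lia.
  case=> p [eup rp dp]; have [p1 p2] := skE up k x p.
  exists p; split; [by rewrite rp | by rewrite dp | ].
  by apply: (@link_pass _ CQ _ _ _ u) => //; rewrite ?s1 ?s2 ?p1 ?p2 ?rp // sym.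
have [u [ru du Qu]] := Up B (leqnn B).
rewrite subnn leqn0 in du; move/eqP: du => du.
rewrite /sweep -/up; set y := run up B x in Qu *.
set dn := fun i => (i, i.+1).
have skY t : rid (y t) = rid (x t) /\ dep (y t) = dep (x t) by apply: skE.
have Down k : k <= B -> forall t, rid (x t) = rid (x v) -> dep (x t) <= k ->
    Q (run dn k y t).
  elim: k => [|k IH] kB t rt.
    (* Vertices of depth 0 in one cluster all have its name as ID, so the root is unique. *)
    rewrite leqn0 => /eqP dt; have -> // : t = u; apply: inj.
    have := lx t; have := lx u; rewrite du dt ru rt => <- //.
  rewrite leq_eqVlt => /orP [/eqP dt|dt]; last first.
    by apply: link_keep => //; apply: IH => //; apply: ltnW.
  have := lx t; rewrite dt => -[p [etp rp dp]].
  have [p1 p2] := skE dn k y p; have [t1 t2] := skE dn k y t.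
  have [P1 P2] := skY p; have [T1 T2] := skY t.
  apply: (@link_pass _ CQ _ _ _ p) => //=; rewrite ?p2 ?t2 ?p1 ?t1 ?P2 ?T2 ?P1 ?T1 //.
  by apply: IH; rewrite ?rp ?dp // ltnW.
by apply: Down => //; apply: ltnW.
Qed.

Lemma sweep_mem B v i : n <= B ->
  reflect (exists2 u, rid (x u) = rid (x v) & i \in items (x u))
          (i \in items (sweep B x v)).
Proof.
move=> nB; apply: (iffP idP) => [|[u ru iu]]; last first.
  exact: (sweep_spread (Q := fun x => i \in items x)) (@carried_mem i) nB ru iu.
suff [H _] : (forall v, i \in items (sweep B x v) ->
    exists2 u, rid (x u) = rid (x v) & i \in items (x u))
    /\ (forall v, rid (sweep B x v) = rid (x v)) by apply: H.
apply: (sweep_ind (I := fun y => (forall v, i \in items (y v) ->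
    exists2 u, rid (x u) = rid (x v) & i \in items (x u))
    /\ (forall v, rid (y v) = rid (x v)))) => [a b y [H R]|]; last first.
  by split=> // t it; exists t.
split=> t; last by have := skel_link a b y t; case=> _ -> _ _.
by case/link_mem=> u ru /H [w rw iw]; exists w; rewrite // rw -R ru R.
Qed.

Lemma sweep_know B v k : know (sweep B x v) = Some k -> exists u, know (x u) = Some k.
Proof.
move: v; apply: (sweep_ind (I := fun y => forall v, know (y v) = Some k ->
    exists u, know (x u) = Some k)) => [a b y H v|v]; last by exists v.
by case/link_know=> u /H.
Qed.

(** The first part traces the name in a label to its origin; the second provides the parent in the
    new tree. The label of the parent at the end is the one it passed on, since labels are never
    replaced. *)
Lemma sweep_lab B v l : lab (sweep B x v) = Some l ->
  (exists u l', [/\ rid (x u) = rid (x v), lab (x u) = Some l' & l'.1 = l.1]) /\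
  (lab (x v) = Some l \/ exists u l',
     [/\ e v u, rid (x u) = rid (x v), lab (sweep B x u) = Some l' & l = (l'.1, l'.2.+1)]).
Proof.
pose I y := (forall v, rid (y v) = rid (x v)) /\ forall v l, lab (y v) = Some l ->
  (exists u l', [/\ rid (x u) = rid (x v), lab (x u) = Some l' & l'.1 = l.1]) /\
  (lab (x v) = Some l \/ exists u l',
     [/\ e v u, rid (x u) = rid (x v), lab (y u) = Some l' & l = (l'.1, l'.2.+1)]).
suff [_ H] : I (sweep B x) by apply: H.
apply: sweep_ind => [a b y [R H]|]; last first.
  by split=> // t m lt; split; [exists t, m | left].
split=> [t|t m]; first by have := skel_link a b y t; case=> _ -> _ _.
case/link_lab=> [/H [C [D|[u [l' [etu ru lu E]]]]] | [_ [u [l' [etu ru lu E]]]]].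
- by split=> //; left.
- by split=> //; right; exists u, l'; split=> //; apply: link_lab_keep.
- rewrite !R in ru; have [[w [l'' [rw lw El]]] _] := H _ _ lu; split.
    by exists w, l''; rewrite rw ru El E.
  by right; exists u, l'; split=> //; apply: link_lab_keep.
Qed.
End Labelled.
End Sweep.

(** * One merging stage *)

Section Stage.
Variables (n : nat) (e : rel 'I_n) (id : 'I_n -> nat) (N : nat).
Hypotheses (sym : symmetric e) (inj : injective id).

Definition exchange (q : nat) (x : 'I_n -> core) (v : 'I_n) : core :=
  if mover N q (x v)
  then set_con (x v) (ohead [seq (rid y, (dep y).+1) |
         y <- [seq x u | u <- enum 'I_n & e v u && ~~ mover N q (x u)]])
  else x v.

Definition stage (B q : nat) (x : 'I_n -> core) : 'I_n -> core :=
  let x3 v := finish 2 (exchange q (sweep e B x) v) in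
  let x5 v := finish 4 (sweep e B x3 v) in
  fun v => finish 6 (sweep e B x5 v).

Definition ready (x : 'I_n -> core) : Prop :=
  labelled e id x /\
  forall v, [/\ cid (x v) = id v, items (x v) = [:: id v], con (x v) = None & lab (x v) = None].

(** The decision of [mover] in terms of the actual clusters; the two agree once the first sweep has
    gathered the member IDs. *)
Definition moving (q : nat) (r : 'I_n -> nat) (v : 'I_n) : bool :=
  let j := q %% (up_log 2 N).+1 in
  if j < up_log 2 N then odd ((r v).-1 %/ 2 ^ j)
  else #|cluster r v| < 2 ^ (q %/ (up_log 2 N).+1).+1.

Lemma moving_const q r u v : r u = r v -> moving q r u = moving q r v.
Proof. by move=> E; rewrite /moving /cluster E. Qed.

Lemma labelled_ext x y : (forall v, rid (y v) = rid (x v) /\ dep (y v) = dep (x v)) ->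
  labelled e id x -> labelled e id y.
Proof.
move=> H lx v; have [-> ->] := H v; have := lx v; case: (dep (x v)) => // d [u [e1 e2 e3]].
by exists u; have [-> ->] := H u.
Qed.

Section StageProof.
Variables (B q : nat) (x : 'I_n -> core).
Hypotheses (nB : n <= B) (rx : ready x).

Let r v := rid (x v).
Let d v := dep (x v).
Let M := moving q r.
Let x1 := sweep e B x.
Let x3 v := finish 2 (exchange q x1 v).
Let x4 := sweep e B x3.
Let x5 v := finish 4 (x4 v).
Let x6 := sweep e B x5.
Let c v := con (x3 v).

Lemma stage_skel1 v : skel (x1 v) = (id v, r v, d v, None).
Proof.
rewrite /x1 skel_sweep; case: rx => _ /(_ v) [E _ C _].
by rewrite /skel E C.
Qed.

Lemma stage_mem1 v : size (undup (items (x1 v))) = #|cluster r v|.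
Proof.
have [lx fr] := rx.
rewrite cardE -(size_map id); apply: perm_size; apply: uniq_perm.
- exact: undup_uniq.
- by rewrite map_inj_uniq // enum_uniq.
move=> i; rewrite mem_undup; apply/(sweep_mem lx sym inj _ _ nB)/mapP.
  case=> u ru; case: (fr u) => _ -> _ _; rewrite inE => /eqP ->.
  by exists u; rewrite // mem_enum inE; apply/eqP.
case=> u; rewrite mem_enum inE => /eqP ru ->; exists u => //.
by case: (fr u) => _ -> _ _; rewrite inE.
Qed.

Lemma stage_mover v : mover N q (x1 v) = M v.
Proof.
rewrite /mover /M /moving stage_mem1.
by have [_ -> _ _] := stage_skel1 v.
Qed.

Lemma stage_lab1 v : lab (x1 v) = None.
Proof.
case E: (lab _) => [l|//].
have [[u [l' [_ L _]]] _] := sweep_lab E.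
by case: rx => _ /(_ u) [_ _ _]; rewrite L.
Qed.

Lemma stage_skel3 v : [/\ cid (x3 v) = id v, rid (x3 v) = r v, dep (x3 v) = d v,
  items (x3 v) = (if c v is Some _ then [:: id v] else [::]) & lab (x3 v) = None].
Proof.
have [s1 s2 s3 _] := stage_skel1 v.
rewrite /c /x3 /finish /= /exchange.
by case: (mover _ _ _); rewrite /= ?s1 ?s2 ?s3 stage_lab1.
Qed.

Lemma stage_con v z : c v = Some z ->
  M v /\ exists w, [/\ e v w, ~~ M w & z = (r w, (d w).+1)].
Proof.
rewrite /c /x3 /finish /= /exchange stage_mover.
case: (M v); last by have [_ _ _ ->] := stage_skel1 v.
rewrite /= -map_comp => H; split=> //.
case S: (filter _ _) H => [//|w s] /= [<-].
have : w \in [seq u <- enum 'I_n | e v u & ~~ mover N q (x1 u)] by rewrite S mem_head.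
rewrite mem_filter stage_mover => /andP [/andP [evw Mw] _].
by exists w; have [_ -> -> _] := stage_skel1 w.
Qed.

Lemma stage_con_some v w : M v -> ~~ M w -> e v w -> isSome (c v).
Proof.
move=> Mv Mw evw; rewrite /c /x3 /finish /= /exchange stage_mover Mv /= -map_comp.
have : w \in [seq u <- enum 'I_n | e v u & ~~ mover N q (x1 u)].
  by rewrite mem_filter evw stage_mover Mw mem_enum.
by case: (filter _ _).
Qed.

Lemma stage_labelled3 : labelled e id x3.
Proof. by apply: labelled_ext rx.1 => v; have [_ -> ->] := stage_skel3 v. Qed.

Lemma stage_skel5 v : [/\ cid (x5 v) = id v, rid (x5 v) = r v & dep (x5 v) = d v].
Proof.
have [s1 s2 s3 _ _] := stage_skel3 v; case: (skel_sweep e B x3 v) => t1 t2 t3 _.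
by split; [apply: etrans t1 s1 | apply: etrans t2 s2 | apply: etrans t3 s3].
Qed.

Lemma stage_labelled5 : labelled e id x5.
Proof. by apply: labelled_ext rx.1 => v; have [_ -> ->] := stage_skel5 v. Qed.

(** After the second sweep [items] holds the IDs of all contact vertices of the cluster, so the test
    ending block 4 singles out the least one. *)
Lemma stage_lab5 v z : lab (x5 v) = Some z <->
  c v = Some z /\ forall u, r u = r v -> isSome (c u) -> id v <= id u.
Proof.
have mem4 i := sweep_mem stage_labelled3 sym inj v i nB.
have := skel_sweep e B x3 v; have [s1 s2 s3 _ _] := stage_skel3 v.
case=> s4 s5 s6 s7.
have -> : lab (x5 v) = if all (leq (cid (x4 v))) (items (x4 v)) then con (x4 v) else None by [].
rewrite /x4 s4 s7 s1; split.
  case: allP => // H Cv; split=> // u ru cu; apply: H; apply/mem4; exists u.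
    by have [_ -> _ _ _] := stage_skel3 u; rewrite s2.
  have [_ _ _ -> _] := stage_skel3 u.
  by move: cu; case: (c u) => // y _; rewrite mem_head.
case=> Cv H; case: allP => // -[] i /mem4 [u].
have [_ -> _ -> _] := stage_skel3 u; rewrite s2 => ru.
case Cu: (c u) => [z'|//]; rewrite inE => /eqP ->; apply: H => //; by rewrite Cu.
Qed.

Lemma stage_rid6 v : rid (x6 v) = r v /\ dep (x6 v) = d v /\ cid (x6 v) = id v.
Proof.
have [s1 s2 s3] := stage_skel5 v; case: (skel_sweep e B x5 v) => t1 t2 t3 _.
by split; [apply: etrans t2 s2 | split; [apply: etrans t3 s3 | apply: etrans t1 s1]].
Qed.

Lemma stage_lab6 v u : r u = r v -> isSome (c u) -> isSome (lab (x6 v)).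
Proof.
move=> ru cu; pose P w := (r w == r v) && isSome (c w).
have Pu : P u by rewrite /P ru eqxx.
case: (arg_minnP id Pu) => w /andP [/eqP rw cw] mw.
have l5 : isSome (lab (x5 w)).
  case Cw: (c w) cw => [z|//] _; suff -> : lab (x5 w) = Some z by [].
  apply/stage_lab5; split=> // t rt ct; apply: mw.
  by rewrite /P rt rw eqxx.
have rid5 t : rid (x5 t) = r t by have [_ -> _] := stage_skel5 t.
apply: (sweep_spread stage_labelled5 sym inj (@carried_lab) nB) l5.
by rewrite !rid5.
Qed.

Lemma stage_lab6_origin v z : lab (x6 v) = Some z ->
  exists u z', [/\ r u = r v, lab (x5 u) = Some z' & z'.1 = z.1].
Proof.
move=> E; have [[u [z' [ru lu E']]] _] := sweep_lab E.
have [_ r5 _] := stage_skel5 u; have [_ r5' _] := stage_skel5 v.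
by exists u, z'; rewrite -r5 -r5'.
Qed.

(** Both labels originate at the contact vertex of least ID, unique by injectivity of [id]; thus a
    cluster moves to a single target. *)
Lemma stage_lab6_unique u v z z' : r u = r v ->
  lab (x6 u) = Some z -> lab (x6 v) = Some z' -> z.1 = z'.1.
Proof.
move=> ruv /stage_lab6_origin [w [y [rw lw <-]]] /stage_lab6_origin [w' [y' [rw' lw' <-]]].
move/stage_lab5: (lw) => [cw mw]; move/stage_lab5: (lw') => [cw' mw'].
have E : w = w'.
  apply: inj; apply/eqP; rewrite eqn_leq.
  by rewrite mw ?mw' ?cw ?cw' // ?rw ?rw' // ruv.
by move: lw'; rewrite -E lw => -[->].
Qed.

Lemma stage_lab6_stayer v z : lab (x6 v) = Some z ->
  M v /\ exists2 w, ~~ M w & z.1 = r w.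
Proof.
move=> /stage_lab6_origin [u [z' [ru /stage_lab5 [/stage_con [Mu [w [_ Mw Ez]]] _] <-]]].
by split; [rewrite /M -(moving_const q ru) | exists w; rewrite ?Ez].
Qed.

Lemma stage_lab6_none v : ~~ M v -> lab (x6 v) = None.
Proof. by move=> Mv; case E: (lab _) => [z|//]; have [] := stage_lab6_stayer E; rewrite (negbTE Mv). Qed.

Lemma stage_lab6_const u v : r u = r v -> isSome (lab (x6 u)) -> isSome (lab (x6 v)).
Proof.
move=> ruv; case E: (lab (x6 u)) => [z|//] _.
have [w [z' [rw /stage_lab5 [cw _] _]]] := stage_lab6_origin E.
by apply: (@stage_lab6 v w); rewrite ?rw ?cw.
Qed.

Lemma stage_rid v : rid (stage B q x v) = if lab (x6 v) is Some z then z.1 else r v.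
Proof.
rewrite /stage -/x1 -/x3 -/x4 -/x5 -/x6 /finish /=.
by case: (lab _) => //=; have [-> _] := stage_rid6 v.
Qed.

Lemma stage_dep v : dep (stage B q x v) = if lab (x6 v) is Some z then z.2 else d v.
Proof.
rewrite /stage -/x1 -/x3 -/x4 -/x5 -/x6 /finish /=.
by case: (lab _) => //=; have [_ [-> _]] := stage_rid6 v.
Qed.

Lemma stage_ready : ready (stage B q x).
Proof.
split=> v; last first.
  rewrite /stage -/x1 -/x3 -/x4 -/x5 -/x6 /finish /=.
  by have [_ [_ <-]] := stage_rid6 v; case: (lab _).
rewrite stage_rid stage_dep; case E: (lab (x6 v)) => [z|].
  have [_ [|[u [l [evu _ lu Ez]]]]] := sweep_lab E.
    (* For the deciding contact vertex, the new parent is the stayer [w], whose name and depth do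
       not change in this stage. *)
    move/stage_lab5=> [/stage_con [_ [w [evw Mw ->]]] _] /=.
    by exists w; rewrite stage_rid stage_dep stage_lab6_none.
  by rewrite Ez; exists u; rewrite stage_rid stage_dep lu.
(* Without a new label the old parent serves: labels reach all of a cluster or none of it, so the
   parent has no new label either. *)
have := rx.1 v; rewrite -/(d v) -/(r v); case: (d v) => // k [u [evu ru du]].
exists u; rewrite stage_rid stage_dep.
case Eu: (lab (x6 u)) => [z|//].
by have := @stage_lab6_const u v ru; rewrite Eu E => /(_ isT).
Qed.

Lemma stage_absorb : absorb e M r (fun v => rid (stage B q x v)).
Proof.
split=> [u v|u v ruv|v Mv|v|u w Mu Mw euw].
- exact: moving_const.
- rewrite !stage_rid; have := @stage_lab6_const u v ruv; have := @stage_lab6_const v u (esym ruv).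
  case Eu: (lab (x6 u)) => [z|]; case Ev: (lab (x6 v)) => [z'|] //.
  + by move=> _ _; apply: stage_lab6_unique Eu Ev.
  + by move=> _ /(_ isT).
  + by move=> /(_ isT).
- by rewrite stage_rid stage_lab6_none.
- rewrite stage_rid; case E: (lab _) => [z|]; last by left.
  by right; have [_ []] := stage_lab6_stayer E => w; exists w.
- rewrite stage_rid; have := stage_lab6 (erefl (r u)) (stage_con_some Mu Mw euw).
  case E: (lab _) => [z|//] _; have [_ [w' Mw' ->]] := stage_lab6_stayer E.
  (* The new name is that of the stayer [w']; keeping the old name would make [w'] a mover like
     [u]. *)
  by apply: contraNneq Mw' => H; rewrite /M (moving_const q H).
Qed.

End StageProof.

Lemma finish_know b y : know (finish b y) = know y.
Proof. by rewrite /finish; case: (b %% 7) => [|[|[|[|[|[|[|k]]]]]]] //=; case: (lab y). Qed.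

Lemma exchange_know q x v : know (exchange q x v) = know (x v).
Proof. by rewrite /exchange; case: ifP. Qed.

Lemma stage_know B q x v :
  isSome (know (sweep e B x v)) -> isSome (know (stage B q x v)).
Proof.
have keep y w : isSome (know (y w)) -> isSome (know (sweep e B y w)).
  exact: (sweep_keep e carried_know).
move=> H; rewrite /stage finish_know; apply: (keep).
by rewrite finish_know; apply: (keep); rewrite finish_know exchange_know.
Qed.

Lemma stage_know_origin B q x v k :
  know (stage B q x v) = Some k -> exists u, know (x u) = Some k.
Proof.
rewrite /stage finish_know => /sweep_know [u].
rewrite finish_know => /sweep_know [w].
by rewrite finish_know exchange_know => /sweep_know.
Qed.
End Stage.

(** * Execution of the algorithm *)

Section Execution.
Variables (n N : nat) (e : rel 'I_n) (id : 'I_n -> nat) (s : 'I_n) (m : nat).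
Let B := 2 * n.
Let st := state merging_algorithm N e id s m.
Let cores t v := vcore (st t v).

Definition active (a : action core) : bool := if a is Idle then false else true.

Definition slot (b i : nat) (x : 'I_n -> core) (v : 'I_n) : core :=
  core_upd b (x v)
    (if core_act N B b i (x v) is Listen then
       Some (pmap (fun u => if e v u
               then if core_act N B b i (x u) is Transmit y then Some y else None
               else None) (enum 'I_n))
     else None).

Fixpoint block (b k : nat) (x : 'I_n -> core) : 'I_n -> core :=
  if k is k'.+1 then slot b k' (block b k' x) else x.

Lemma n_gt0 : 0 < n. Proof. exact: leq_ltn_trans (ltn_ord s). Qed.

Lemma B_gt0 : 0 < B. Proof. by rewrite muln_gt0 n_gt0. Qed.

Lemma st_static t v : [/\ vn (st t v) = n, vN (st t v) = N & clock (st t v) = t].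
Proof. by elim: t => [|t [IH1 IH2 IH3]] //; split=> //=; congr S. Qed.


Lemma st_act b i v : i < B ->
  vs_act (st (B * b + i) v) = core_act N B b i (cores (B * b + i) v).
Proof.
move=> iB; rewrite /vs_act; have [-> -> ->] := st_static (B * b + i) v; rewrite -/B.
by rewrite mulnC divnMDl ?B_gt0 // divn_small // addn0 modnMDl modn_small.
Qed.

Lemma cores_step b i : i < B -> cores (B * b + i).+1 =
  (fun v => (if i.+1 == B then finish b else fun x => x) (slot b i (cores (B * b + i)) v)).
Proof.
move=> iB; apply: functional_extensionality => v.
rewrite {1}/cores {1}/st /= -/st.
have -> : received (A := merging_algorithm) e (st (B * b + i)) v =
    pmap (fun u => if e v u
               then if core_act N B b i (cores (B * b + i) u) is Transmit y then Some y else None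
               else None) (enum 'I_n).
  by apply: eq_pmap => u; rewrite /= st_act.
rewrite /step /= st_act // /slot.
have [-> _ ->] := st_static (B * b + i) v; rewrite -/B.
have -> : (B * b + i) %/ B = b by rewrite mulnC divnMDl ?B_gt0 // divn_small // addn0.
have -> : (B * b + i) %% B = i by rewrite mulnC modnMDl modn_small.
rewrite -/(cores (B * b + i) v).
by case: (core_act _ _ _ _ _) => [y||] /=; case: eqP.
Qed.

Lemma cores_block b k : k < B -> cores (B * b + k) = block b k (cores (B * b)).
Proof.
elim: k => [|k IH] kB /=; first by rewrite addn0.
by rewrite addnS cores_step ?(ltnW kB) // IH ?(ltnW kB) // ltn_eqF.
Qed.

Lemma cores_block_end b :
  cores (B * b.+1) = (fun v => finish b (block b B (cores (B * b)) v)).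
Proof.
have E : B * b.+1 = (B * b + B.-1).+1 by rewrite -addnS prednK ?B_gt0 // mulnSr.
rewrite {}E cores_step ?prednK ?B_gt0 // eqxx cores_block ?prednK ?B_gt0 //.
have -> : block b B (cores (B * b)) = slot b B.-1 (block b B.-1 (cores (B * b))).
  by rewrite -{1}(prednK B_gt0).
by [].
Qed.

Lemma pmap_if (I : Type) (T : Type) (P : pred I) (f : I -> T) r :
  pmap (fun u => if P u then Some (f u) else None) r = [seq f u | u <- r & P u].
Proof. by elim: r => //= u r ->; case: (P u). Qed.

(** On the upward schedule truncated subtraction would give 0 twice if [i] reached [B]. Distinct
    depths mean that no vertex has to transmit and listen in one slot. *)
Lemma link_of_neq k i : i < B -> (link_of B k i).1 != (link_of B k i).2.
Proof. by rewrite /link_of; case: ifP => _ /= iB; lia. Qed.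

Lemma slot_link b i x : i < B -> b %% 7 != 2 ->
  slot b i x = link e (link_of B (b %% 7) i).1 (link_of B (b %% 7) i).2 x.
Proof.
move=> iB b2; apply: functional_extensionality => v.
have ne := link_of_neq (b %% 7) iB; move: ne.
rewrite /slot /core_act /core_upd /link (negbTE b2).
case: (link_of _ _ _) => a c /= ne.
have [dv|] := eqVneq (dep (x v)) c; last by case: ifP.
rewrite dv eq_sym (negbTE ne); congr merge.
rewrite -pmap_if; apply: eq_pmap => u.
by case: (e v u) => //=; case: ifP => // _; case: ifP.
Qed.

Lemma block_run b k x : k <= B -> b %% 7 != 2 ->
  block b k x = run e (link_of B (b %% 7)) k x.
Proof.
move=> kB b2; elim: k kB => //= k IH kB.
by rewrite slot_link // IH // ltnW.
Qed.

Lemma block_exchange b x : b %% 7 = 2 -> block b B x = exchange e N (b %/ 7) x.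
Proof.
move=> b2.
have idle i y : 0 < i -> slot b i y = y.
  case: i => // i _; apply: functional_extensionality => v.
  by rewrite /slot /core_act b2.
have E k : block b k.+1 x = slot b 0 x by elim: k => //= k <-; rewrite idle.
rewrite -(prednK B_gt0) E; apply: functional_extensionality => v.
rewrite /slot /core_act b2 /= /core_upd b2 /= /exchange.
case: (mover N (b %/ 7) (x v)) => //=; congr (set_con _ (ohead (map _ _))).
rewrite -pmap_if; apply: eq_pmap => u.
by case: (e v u) => //=; case: (mover _ _ _).
Qed.

(** [finish] is the identity after blocks 0, 1, 3 and 5, so the seven blocks compose by conversion
    to three sweeps with the exchange after the first. *)
Lemma cores_stage q : cores (B * (7 * q.+1)) = stage e N B q (cores (B * (7 * q))).
Proof.
have md k : k < 7 -> (7 * q + k) %% 7 = k by move=> ?; rewrite mulnC modnMDl modn_small.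
have fin k : k < 7 -> finish (7 * q + k) = finish k.
  by move=> k7; rewrite /finish md // modn_small.
have next k : k < 7 -> k != 2 -> cores (B * (7 * q + k.+1)) =
    (fun v => finish k (run e (link_of B k) B (cores (B * (7 * q + k))) v)).
  by move=> k7 k2; rewrite addnS cores_block_end block_run ?md // fin.
have next2 : cores (B * (7 * q + 3)) =
    (fun v => finish 2 (exchange e N q (cores (B * (7 * q + 2))) v)).
  rewrite addnS cores_block_end block_exchange ?md // fin //.
  by rewrite mulnC divnMDl // divn_small // addn0.
rewrite mulnS addnC next // next // next // next // next2 next // next // addn0.
by [].
Qed.

(** * Energy spent per block *)

Lemma dep_block b k x v : dep (block b k x v) = dep (x v).
Proof.
elim: k => //= k <-; rewrite /slot /core_upd.
by case: (core_act _ _ _ _ _) => //=; case: ifP.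
Qed.

Lemma count_leq2 (P : pred nat) r a b : uniq r ->
  (forall i, i \in r -> P i -> i = a \/ i = b) -> count P r <= 2.
Proof.
move=> Ur H; rewrite -size_filter.
apply: (uniq_leq_size (s2 := [:: a; b])); first exact: filter_uniq.
move=> i; rewrite mem_filter => /andP [Pi ri].
by rewrite !inE; case: (H i ri Pi) => ->; rewrite eqxx ?orbT.
Qed.

Lemma energy_block b v :
  count (fun t => active (vs_act (st t v))) (iota (B * b) B) <= 2.
Proof.
pose d := dep (cores (B * b) v).
rewrite -[B * b]addn0 iotaDl count_map.
(* The transmitting and the listening slot of depth [d], which is constant during a block: [B - d]
   and [B - d.+1] towards the root, [d] and [d.-1] on the way back. Block 2 is active in slot 0
   only. *)
apply: (@count_leq2 _ _ (if b %% 7 == 2 then 0 else if b %% 7 \in [:: 0; 3; 5] then B - d else d)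
  (if b %% 7 \in [:: 0; 3; 5] then B - d.+1 else d.-1)) => [|i]; first exact: iota_uniq.
rewrite mem_iota add0n => /andP [_ iB] /=.
rewrite st_act // cores_block // /core_act dep_block -/d.
case: ifP => _; first by case: eqP => [->|]; [left|].
rewrite /link_of; case: (b %% 7 \in _) => /=.
  have [->|_] := eqVneq d (B - i); first by left; lia.
  by have [->|//] := eqVneq d (B - i.+1); right; lia.
have [->|_] := eqVneq d i; first by left.
by have [->|//] := eqVneq d i.+1; right.
Qed.

Lemma energy_blocks b v : energy_of merging_algorithm N e id s m (B * b) v <= 2 * b.
Proof.
elim: b => [|b IH]; first by rewrite muln0.
rewrite /energy_of mulnSr iotaD add0n count_cat mulnSr leq_add //.
exact: energy_block.
Qed.

(** * Convergence to one cluster and delivery of the message *)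

Let X q := cores (B * (7 * q)).

Hypotheses (cg : connected_graph e) (vi : valid_ids N id).

Let sym : symmetric e. Proof. by case: cg => _ []. Qed.
Let conn : forall x y, connect e x y. Proof. by case: cg => _ []. Qed.
Let inj : injective id. Proof. by case: vi. Qed.
Let nB : n <= B. Proof. by rewrite leq_pmull. Qed.

Lemma X_ready q : ready e id (X q).
Proof.
elim: q => [|q IH]; last by rewrite /X cores_stage; apply: stage_ready.
by rewrite /X !muln0; split.
Qed.

Lemma X_absorb q : absorb e (moving N q (fun v => rid (X q v)))
  (fun v => rid (X q v)) (fun v => rid (X q.+1 v)).
Proof.
have := stage_absorb N sym inj q nB (X_ready q).
by rewrite /X cores_stage.
Qed.

Lemma X_rid q v : 0 < rid (X q v) <= 2 ^ up_log 2 N.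
Proof.
have [u [_ _ ->]] := labelled_root (X_ready q).1 v.
have /andP [-> le] := vi.2 u; exact: leq_trans le (up_logP _ _).
Qed.

Let single q := forall u v, rid (X q u) = rid (X q v).

Lemma single_leq q q' : q <= q' -> single q -> single q'.
Proof.
move=> le Sq; rewrite -(subnKC le); elim: (q' - q) => [|k IH]; first by rewrite addn0.
rewrite addnS => u v; exact: (absorb_const (X_absorb (q + k))).
Qed.

(** Phase [p] consists of the stages [p * L.+1 + j] with [j <= L]; [phase_double] applies to it with
    [h = 2 ^ p]. A single cluster remains single. *)
Lemma phases p : single (p * (up_log 2 N).+1) \/
  forall v, 2 ^ p <= #|cluster (fun u => rid (X (p * (up_log 2 N).+1) u)) v|.
Proof.
set L := up_log 2 N; elim: p => [|p [IH|IH]].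
- by right=> v; apply/card_gt0P; exists v; rewrite inE.
- by left; apply: single_leq IH; rewrite leq_mul2r leqnSn orbT.
pose r j v := rid (X (p * L.+1 + j) v).
have dm j : j <= L -> (p * L.+1 + j) %% L.+1 = j /\ (p * L.+1 + j) %/ L.+1 = p.
  by move=> jL; rewrite modnMDl modn_small // divnMDl // divn_small // addn0.
have bits j : j < L -> absorb e (fun v => odd ((r j v).-1 %/ 2 ^ j)) (r j) (r j.+1).
  move=> jL; have := X_absorb (p * L.+1 + j); rewrite /moving -/L.
  by have [-> _] := dm j (ltnW jL); rewrite jL -addnS.
have last : absorb e (fun v => #|cluster (r L) v| < (2 ^ p).*2) (r L) (r L.+1).
  have := X_absorb (p * L.+1 + L); rewrite /moving -/L.
  have [-> ->] := dm L (leqnn L); rewrite ltnn -addnS.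
  by rewrite expnS mul2n.
have start v : 2 ^ p <= #|cluster (r 0) v| by rewrite /r addn0.
have [H|H] := phase_double sym conn (fun j v => X_rid _ v) bits last start.
  by left; apply: single_leq H; rewrite mulSnr leq_add2l.
by right=> v; rewrite expnS mul2n mulSnr; apply: H.
Qed.

Lemma single_final : single (up_log 2 n * (up_log 2 N).+1).
Proof.
have [//|H] := phases (up_log 2 n) => u v.
set r := fun u => _ in H; have full : cluster r v = setT.
  apply/eqP; rewrite eqEcard subsetT cardsT card_ord.
  exact: leq_trans (up_logP _ _) (H v).
by have := in_setT u; rewrite -full inE => /eqP.
Qed.

Lemma X_know q v k : know (X q v) = Some k -> k = m.
Proof.
elim: q v => [|q IH] v.
  by rewrite /X !muln0 /cores /=; case: eqP => // _ [].
by rewrite /X cores_stage => /stage_know_origin [u /IH].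
Qed.

Lemma X_know_keep q v : isSome (know (X q v)) -> isSome (know (X q.+1 v)).
Proof.
move=> H; rewrite /X cores_stage; apply: stage_know.
exact: (sweep_keep e carried_know).
Qed.

Lemma X_know_leq q q' v : q <= q' -> isSome (know (X q v)) -> isSome (know (X q' v)).
Proof.
move=> le H; rewrite -(subnKC le); elim: (q' - q) => [|k IH]; first by rewrite addn0.
by rewrite addnS; apply: X_know_keep.
Qed.

Lemma X_know_source q : isSome (know (X q s)).
Proof. by apply: (X_know_leq (leq0n q)); rewrite /X !muln0 /cores /= eqxx. Qed.

(** The first sweep of the stage spreads the message from the source through the only cluster. *)
Lemma X_know_single q v : single q -> isSome (know (X q.+1 v)).
Proof.
move=> Sq; rewrite /X cores_stage; apply: stage_know.
apply: (sweep_spread (X_ready q).1 sym inj carried_know nB (Sq s v)).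
exact: X_know_source.
Qed.

Lemma X_know_final v :
  know (X ((up_log 2 n).+1 * (up_log 2 N).+1) v) = Some m.
Proof.
(* After the merging phases one more stage suffices, and the extra phase contains it. *)
have le : (up_log 2 n * (up_log 2 N).+1).+1 <= (up_log 2 n).+1 * (up_log 2 N).+1.
  by rewrite mulSnr -addn1 leq_add2l.
have := X_know_leq le (X_know_single v single_final).
by case E: (know _) => [k|//] _; rewrite (X_know E).
Qed.
End Execution.

(* O(n log n log N) time and O(log n log N) energy; logs rounded up and
   shifted by one so that the bounds are meaningful for n = 1 or N = 1. *)
Theorem theorem9 :
  exists (A : algorithm) (c : nat),
    forall (n N : nat) (e : rel 'I_n) (id : 'I_n -> nat) (s : 'I_n) (m : nat),
      connected_graph e -> valid_ids N id ->
      solves_broadcast A N e id s m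
        (c * (n * (up_log 2 n).+1 * (up_log 2 N).+1))
        (c * ((up_log 2 n).+1 * (up_log 2 N).+1)).
Proof.
(* Seven blocks of 2n slots per stage, and two active slots per block. *)
exists merging_algorithm, 14 => n N e id s m cg vi.
set P := (up_log 2 n).+1; set S := (up_log 2 N).+1.
have -> : 14 * (n * P * S) = 2 * n * (7 * (P * S)) by nia.
split=> v; first exact: X_know_final.
by apply: leq_trans (energy_blocks _ _ _ _ _ _ _) _; rewrite mulnA.
Qed.
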